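(* Let $F=f+\psi$ and let $\{x_k\}_{k\ge 0}$ be the iterates of the Super-Universal Newton Method (described in the context) with parameters $\alpha\in[\tfrac23,1]$ and $H_0>0$. Assume that the initial sublevel set $\mathcal F_0=\{x\in\operatorname{dom}\psi:\ F(x)\le F(x_0)\}$ is bounded, with $D=\sup_{x,y\in\mathcal F_0}\|x-y\|<+\infty$. Let $M_q<+\infty$ for some $q\in[2,4]$ and let the initial value satisfy $H_0\le\mathcal H_\alpha(g_0)$. Then, for all $k\ge 1$, $$F(x_k)-F_*\ \le\ 6M_qD^q\Bigl(\frac{32(q-1)}{k}\Bigr)^{q-1}+g_0D\exp\Bigl(-\frac k4\Bigr).$$
   Context: Spaces and norms. $\mathbb E$ is a finite-dimensional real vector space, $\mathbb E^*$ its dual, $\langle s,x\rangle$ the value of $s\in\mathbb E^*$ at $x\in\mathbb E$. $B:\mathbb E\to\mathbb E^*$ is a fixed self-adjoint positive-definite linear operator; $\|x\|=\langle Bx,x\rangle^{1/2}$ on $\mathbb E$ and $\|s\|_*=\langle s,B^{-1}s\rangle^{1/2}$ on $\mathbb E^*$. Norms of symmetric multilinear forms are induced: $\|\nabla^pf(x)\|=\max\{\nabla^pf(x)[h_1,\dots,h_p]:\ \|h_i\|\le1\}$. Notation: $\nabla^2 f(x)[h]^2=\langle\nabla^2f(x)h,h\rangle$. Problem. $\min_{x\in\operatorname{dom}\psi}\{F(x)=f(x)+\psi(x)\}$, where $f:\mathbb E\to\mathbb R$ is convex and several times differentiable and $\psi:\mathbb E\to\mathbb R\cup\{+\infty\}$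 is a proper closed convex function; $F_*$ is the optimal value. Smoothness constants. $L_{p,\nu}=\sup_{x\ne y}\|\nabla^pf(x)-\nabla^pf(y)\|/\|x-y\|^\nu$ for $p\in\{2,3\}$, $\nu\in[0,1]$ (equal to $+\infty$ if the supremum is infinite or $\nabla^pf$ does not exist). For $2\le q\le4$: $M_{2+\nu}=L_{2,\nu}$ for $\nu\in[0,1)$ and $M_{3+\nu}=L_{3,\nu}$ for $\nu\in[0,1]$. Function $\mathcal H_\alpha$. For $t>0$, $\mathcal H_\alpha(t)=\inf_{2\le q\le4}(6M_q)^{\frac1{q-1}}\bigl(\tfrac1t\bigr)^{\alpha-\frac{q-2}{q-1}}$. Super-Universal Newton Method. Input: $x_0\in\operatorname{dom}\psi$, $\psi'(x_0)\in\partial\psi(x_0)$, arbitrary $\alpha\in[\frac23,1]$, $H_0>0$. For $k=0,1,\dots$: set $F'(x_k)=\nabla f(x_k)+\psi'(x_k)$ and $g_k=\|F'(x_k)\|_*$. For $j_k=0,1,2,\dots$ put $\lambda_k=4^{j_k}H_kg_k^\alpha$, $x_+=\operatorname{argmin}_x\{\langle\nabla f(x_k),x-x_k\rangle+\frac12\nabla^2f(x_k)[x-x_k]^2+\frac{\lambda_k}2\|x-x_k\|^2+\psi(x)\}$, $\psi'(x_+)=-\nabla f(x_k)-\nabla^2f(x_k)(x_+-x_k)-\lambda_kB(x_+-x_k)\in\partial\psi(x_+)$, $F'(x_+)=\nabla f(x_+)+\psi'(x_+)$, stopping at the first $j_k$ for which $\langle F'(x_+),x_k-x_+\rangle\ge\frac{1}{4\lambda_k}\|F'(x_+)\|_*^2$.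 Then set $x_{k+1}=x_+$ (with the corresponding $\psi'(x_{k+1})$) and $H_{k+1}=4^{j_k}H_k/4$. Here $g_0>0$; if $g_k=0$ for some $k$, then $x_k$ is a minimizer, the method stops, and one sets $x_i=x_k$, $g_i=0$ for $i>k$. *)

(* Defs.v *)
From HB Require Import structures.
From mathcomp Require Import all_boot all_order all_algebra.
From mathcomp Require Import all_classical all_reals all_analysis.
From mathcomp Require Import ring lra.

Set Implicit Arguments.
Unset Strict Implicit.
Unset Printing Implicit Defensive.

Import Order.TTheory GRing.Theory Num.Theory.
Import numFieldNormedType.Exports.

Local Open Scope classical_set_scope.
Local Open Scope ring_scope.

Definition dual (R : realType) (V : vectType R) := 'Hom(V, R^o).

Record spd_op (R : realType) (V : vectType R) := SpdOp {
  spd_lfun :> 'Hom(V, dual V);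
  spd_sym : forall x y : V, spd_lfun x y = spd_lfun y x;
  spd_pos : forall x : V, x != 0 -> 0 < spd_lfun x x }.

(* A copy of V carrying the norm x |-> <B x, x>^(1/2); topology and
   differentiability on it are those of this norm. *)
Definition euclid (R : realType) (V : vectType R) (B : spd_op V) : Type := V.

Section EuclidNorm.
Context (R : realType) (V : vectType R) (B : spd_op V).
Implicit Types x y : V.

HB.instance Definition _ := Vector.on (euclid B).

Definition bnorm (x : euclid B) : R := Num.sqrt (B x x).

Lemma spd_ge0 x : 0 <= B x x.
Proof.
by have [->|/(spd_pos B)/ltW//] := eqVneq x 0; rewrite linear0.
Qed.

Lemma spdDD (a : R) x y :
  B (x + a *: y) (x + a *: y) = B x x + 2 * a * B x y + a ^+ 2 * B y y.
Proof.
rewrite !linearD /= !add_lfunE !linearZ /= !scale_lfunE !linearZ /=.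
by rewrite (spd_sym B y x) /GRing.scale /=; ring.
Qed.

Lemma spd_CS x y : B x y <= Num.sqrt (B x x) * Num.sqrt (B y y).
Proof.
have [y0|yN0] := eqVneq y 0; first by rewrite y0 !linear0 sqrtr0 mulr0.
have Byy := spd_pos B yN0.
rewrite -sqrtrM ?spd_ge0// (le_trans (ler_norm _))// -sqrtr_sqr.
rewrite ler_sqrt ?mulr_ge0 ?spd_ge0//.
have := spd_ge0 (x + (- (B x y / B y y)) *: y); rewrite spdDD.
rewrite -(pmulr_lge0 _ Byy) => h; rewrite -subr_ge0; apply: le_trans h _.
by rewrite le_eqVlt; apply/orP; left; apply/eqP; field; rewrite gt_eqF.
Qed.

Lemma ler_bnormD (x y : euclid B) : bnorm (x + y) <= bnorm x + bnorm y.
Proof.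
rewrite -(@ler_pXn2r _ 2)// ?nnegrE ?addr_ge0 ?sqrtr_ge0//.
rewrite sqr_sqrtr ?spd_ge0//.
have := spdDD 1 x y; rewrite scale1r => ->.
rewrite sqrrD !sqr_sqrtr ?spd_ge0//.
by have := spd_CS x y; rewrite /bnorm; lra.
Qed.

Lemma bnormZ (l : R) (x : euclid B) : bnorm (l *: x) = `|l| * bnorm x.
Proof.
have -> : bnorm (l *: x) = Num.sqrt (l ^+ 2 * B x x).
  have := spdDD l 0 x; rewrite /bnorm !add0r => ->; congr Num.sqrt.
  by rewrite !linear0 zero_lfunE mulr0 !add0r.
by rewrite sqrtrM ?sqr_ge0// sqrtr_sqr.
Qed.

Lemma bnorm_eq0 (x : euclid B) : bnorm x = 0 -> x = 0.
Proof.
move=> /eqP; rewrite sqrtr_eq0 => h; apply/eqP; apply: contraTT h => xN0.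
by rewrite -ltNge; exact: spd_pos.
Qed.

HB.instance Definition _ :=
  @Lmodule_isNormed.Build R (euclid B) bnorm ler_bnormD bnormZ bnorm_eq0.

End EuclidNorm.

Section SuperUniversalNewton.
Context (R : realType) (V : vectType R) (B : spd_op V).
Local Notation E := (euclid B).

Definition dnorm (s : dual E) : R := Num.sqrt (s ((B^-1)%VF s)).

(* nabla f [:: h_1; ...; h_p] x is the derivative \nabla^p f(x)[h_1, ..., h_p],
   obtained by differentiating along h_p first. *)
Fixpoint nabla (f : E -> R) (hs : seq E) : E -> R :=
  if hs is h :: hs' then fun x => 'd (nabla f hs') x h else f.

(* Since E is finite-dimensional, \nabla^k f is Frechet differentiable iff all
   its components \nabla^k f(.)[h_1, ..., h_k] are. *)
Definition times_differentiable (p : nat) (f : E -> R) :=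
  forall hs : seq E, (size hs < p)%N ->
  forall x : E, differentiable (nabla f hs) x.

Definition grad (f : E -> R) (x : E) : dual E :=
  linfun (fun h : E => nabla f [:: h] x : R^o).

Definition hess (f : E -> R) (x : E) : 'Hom(E, dual E) :=
  linfun (fun h : E => linfun (fun u : E => nabla f [:: h; u] x : R^o) : dual E).

Local Open Scope ereal_scope.

Definition form_norm (p : nat) (A : p.-tuple E -> R) : \bar R :=
  ereal_sup [set (A h)%:E | h in [set h | forall i, (`|tnth h i| <= 1)%R]].

Definition smoothness (f : E -> R) (p : nat) (nu : R) : \bar R :=
  if `[< times_differentiable p f >] then
    ereal_sup [set form_norm (fun h : p.-tuple E => nabla f h z.1 - nabla f h z.2)%R
                   * ((`|z.1 - z.2| `^ nu)^-1)%:E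
              | z in [set z : E * E | z.1 <> z.2]]
  else +oo.

Definition Mconst (f : E -> R) (q : R) : \bar R :=
  if (q < 3)%R then smoothness f 2 (q - 2) else smoothness f 3 (q - 3).

Definition Hfun (f : E -> R) (alpha t : R) : \bar R :=
  ereal_inf [set (6%:E * Mconst f q) `^ (q - 1)^-1
                 * ((1 / t) `^ (alpha - (q - 2) / (q - 1)))%:E
            | q in [set q : R | (2 <= q <= 4)%R]].

Definition dom (psi : E -> \bar R) : set E := [set x | psi x < +oo].

Definition proper_fun (psi : E -> \bar R) :=
  (forall x, -oo < psi x) /\ dom psi !=set0.

Definition closed_fun (psi : E -> \bar R) :=
  closed [set z : E * R | psi z.1 <= z.2%:E].

Definition econvex_fun (psi : E -> \bar R) :=
  forall (x y : E) (t : R), (0 <= t <= 1)%R ->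
  psi (t *: x + (1 - t) *: y)%R <= t%:E * psi x + (1 - t)%:E * psi y.

Definition subdiff (psi : E -> \bar R) (x : E) : set (dual E) :=
  [set s | dom psi x /\ forall y : E, psi x + (s (y - x)%R)%:E <= psi y].

Definition objective (f : E -> R) (psi : E -> \bar R) (x : E) : \bar R :=
  (f x)%:E + psi x.

Definition opt_value (f : E -> R) (psi : E -> \bar R) : \bar R :=
  ereal_inf [set objective f psi x | x in dom psi].

Definition sublevel (f : E -> R) (psi : E -> \bar R) (x0 : E) : set E :=
  [set x | dom psi x /\ objective f psi x <= objective f psi x0].

Definition diam (A : set E) : \bar R :=
  ereal_sup [set `|z.1 - z.2|%:E | z in A `*` A].

Definition newton_model (f : E -> R) (psi : E -> \bar R) (xk : E) (lam : R)
    (x : E) : \bar R :=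
  (grad f xk (x - xk) + 1 / 2 * hess f xk (x - xk) (x - xk)
   + lam / 2 * `|x - xk| ^+ 2)%R%:E + psi x.

Definition argmin (G : E -> \bar R) : set E :=
  [set x | forall y, G x <= G y].

Local Open Scope ring_scope.

Definition newton_subgrad (f : E -> R) (xk : E) (lam : R) (xp : E) : dual E :=
  - grad f xk - hess f xk (xp - xk) - lam *: (B (xp - xk) : dual E).

Definition accepted (f : E -> R) (xk : E) (lam : R) (xp : E) : Prop :=
  let Fp : dual E := grad f xp + newton_subgrad f xk lam xp in
  Fp (xk - xp) >= 1 / (4 * lam) * dnorm Fp ^+ 2.

Definition grad_size (f : E -> R) (x : nat -> E) (s : nat -> dual E)
    (k : nat) : R :=
  dnorm (grad f (x k) + s k).

(* x k, s k = psi'(x_k), H k = H_k and j k = j_k record a run of the method;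
   z k i is the trial point of the inner loop of iteration k for j_k = i.
   After a step k with g_k = 0 the sequences x and s stay constant, so that
   g_i = 0 for all i > k. That s k.+1 is a subgradient of psi at x k.+1 is not
   required: it is the optimality condition of the subproblem. *)
Definition super_universal_newton (f : E -> R) (psi : E -> \bar R)
    (alpha H0 : R) (x : nat -> E) (s : nat -> dual E) (H : nat -> R)
    (j : nat -> nat) (z : nat -> nat -> E) : Prop :=
  let g := grad_size f x s in
  let lam k i := 4 ^+ i * H k * g k `^ alpha in
  [/\ dom psi (x 0), subdiff psi (x 0) (s 0), H 0 = H0 &
   forall k,
   (g k = 0 -> x k.+1 = x k /\ s k.+1 = s k) /\
   (0 < g k ->
     [/\ forall i, (i <= j k)%N ->
           argmin (newton_model f psi (x k) (lam k i)) (z k i),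
         forall i, (i < j k)%N -> ~ accepted f (x k) (lam k i) (z k i),
         accepted f (x k) (lam k (j k)) (z k (j k)),
         x k.+1 = z k (j k) /\
         s k.+1 = newton_subgrad f (x k) (lam k (j k)) (x k.+1) &
         H k.+1 = 4 ^+ j k * H k / 4])].

End SuperUniversalNewton.

(* Main.v *)
(* With h = x_+ - x and e = grad f(x_+) - grad f(x) - hess f(x) h one has
   F'(x_+) = e - lambda B h, so the acceptance test follows from
   |e|_* <= lambda |h|. Optimality of the step and monotonicity of the
   subdifferential give <hess f(x) h, h> + lambda |h|^2 <= g |h|. For q < 3 the
   Hoelder bound on the Hessian estimates e; for q >= 3 convexity controls the
   third derivative by the Hessian. Either way lambda is accepted as soon as
   lambda >= (6 M_q)^(1/(q-1)) g^((q-2)/(q-1)), and hence H_k is at most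
   (6 M_q)^(1/(q-1)) (D/delta_k)^theta with theta = alpha - (q-2)/(q-1) and
   delta_k = F(x_k) - F_* <= g_k D.

   With b = 1/(q-1) this gives the recursion
   delta_i - delta_{i+1} >= kap (g_{i+1}/g_i)^alpha delta_{i+1}^(1+b). Put
   w_i = delta_{i+1}^(-b) - delta_i^(-b). Concavity of u |-> u^b turns the
   recursion into b kap (g_{i+1}/g_i)^alpha <= w_i delta_i / delta_{i+1}.
   Multiplying over i < k, the ratios telescope and AM-GM bounds the product
   of the w_i by (delta_k^(-b)/k)^k. If delta_k > g_0 D exp(-k/4), both
   telescoped factors cost at most exp(k/4), whence
   delta_k^b <= exp(1/2)/(b kap k) <= 2/(b kap k). *)

From HB Require Import structures.
Require Import Defs.
From mathcomp Require Import all_boot all_order all_algebra.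
From mathcomp Require Import all_classical all_reals all_analysis.
From mathcomp Require Import ring lra.

Set Implicit Arguments.
Unset Strict Implicit.
Unset Printing Implicit Defensive.

Import Order.TTheory GRing.Theory Num.Theory.
Import numFieldNormedType.Exports.
Local Open Scope classical_set_scope.
Local Open Scope ring_scope.

(** * Differentials along lines and symmetry of second derivatives *)

Section Calculus.
Context (R : realType) (E : normedModType R).
Implicit Types (f g : E -> R) (x y u v h : E).

Lemma diffDr f x h u : 'd f x (h + u) = 'd f x h + 'd f x u.
Proof. exact: linearD. Qed.

Lemma diffZr f x (a : R) h : 'd f x (a *: h) = a * 'd f x h.
Proof. exact: linearZ. Qed.

Lemma is_derive_line f x h (t : R) : differentiable f (x + t *: h) ->
  is_derive t 1 (fun r : R => f (x + r *: h)) ('d f (x + t *: h) h).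
Proof.
move=> df; have dl : is_diff t (fun r : R => x + r *: h) (fun r : R => r *: h).
  have -> : (fun r : R => x + r *: h) = cst x + ( *:%R^~ h) by [].
  by apply: is_diff_eq; apply/funext => r /=; rewrite !fctE/= add0r.
have ddl : differentiable (fun r : R => x + r *: h) t by case: dl.
have dfl : differentiable (f \o (fun r : R => x + r *: h)) t.
  exact: differentiable_comp.
apply: DeriveDef; first exact: diff_derivable.
rewrite deriveE// (diff_comp ddl)//.
by rewrite /= diff_val scale1r.
Qed.

Lemma mvt_unit_interval (phi dphi : R -> R) :
  (forall t : R, is_derive t 1 phi (dphi t)) ->
  exists2 c : R, 0 <= c <= 1 & phi 1 - phi 0 = dphi c.
Proof.
move=> dphiP; have [|c] := @MVT_segment R phi dphi 0 1 ler01.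
  by apply: derivable_within_continuous => t _; apply: ex_derive.
by rewrite in_itv/= subr0 mulr1 => c01 ->; exists c.
Qed.

Lemma mvt_line f x h : (forall y, differentiable f y) ->
  exists2 c : R, 0 <= c <= 1 & f (x + h) - f x = 'd f (x + c *: h) h.
Proof.
move=> df.
have [c c01] := mvt_unit_interval (fun t => @is_derive_line f x h t (df _)).
by rewrite scale1r scale0r addr0 => ?; exists c.
Qed.

Lemma diff_near f x (e : R) : 0 < e -> differentiable f x ->
  exists2 d : R, 0 < d &
    forall h, `|h| < d -> `|f (x + h) - f x - 'd f x h| <= e * `|h|.
Proof.
move=> e0 /diff_locally /eqaddoP /(_ e e0) /nbhs_ballP [d /= d0 dP].
exists d => // h hd.
have := dP h; rewrite -ball_normE/= sub0r normrN => /(_ hd).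
by rewrite !fctE /= opprD addrA (addrC h).
Qed.

(** The mean value theorem in the direction [v] turns the second difference into a difference of
    first derivatives at two points near [x], and each of these is linearized at [x]. *)
Lemma second_difference f x u v : (forall y, differentiable f y) ->
  differentiable (fun y => 'd f y v) x ->
  forall e : R, 0 < e -> exists2 d : R, 0 < d & forall t : R, 0 < t < d ->
    `|f (x + t *: u + t *: v) - f (x + t *: u) - f (x + t *: v) + f x
      - t ^+ 2 * 'd (fun y => 'd f y v) x u| <= e * t ^+ 2.
Proof.
move=> df dfv e e0.
(* The displacements [w1] and [w2] below have norm at most [t * n], so each linearization error is
   at most half of [e * t]. *)
set n := `|u| + `|v| + 1.
have n0 : 0 < n by rewrite ltr_wpDl.
have e20 : 0 < e / (2 * n) by rewrite divr_gt0// mulr_gt0.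
have [d d0 dP] := diff_near e20 dfv.
exists (d / n); first by rewrite divr_gt0.
move=> t /andP[t0 td].
have tn : t * n < d by rewrite -ltr_pdivlMr.
have [|c c01] := @mvt_unit_interval
  (fun r => f ((x + t *: u) + r *: (t *: v)) - f (x + r *: (t *: v)))
  (fun r => 'd f ((x + t *: u) + r *: (t *: v)) (t *: v)
            - 'd f (x + r *: (t *: v)) (t *: v)).
  by move=> r; apply: is_deriveB; apply: is_derive_line.
rewrite !scale1r !scale0r !addr0 !diffZr -mulrBr !scalerA => eqS.
set w1 := t *: u + (c * t) *: v; set w2 := (c * t) *: v.
have cv : c * `|v| <= `|v| by rewrite ler_piMl//; case/andP: c01.
have c0 : 0 <= c by case/andP: c01.
have nw1 : `|w1| <= t * n.
  rewrite (le_trans (ler_normD _ _))// !normrZ (gtr0_norm t0).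
  rewrite ger0_norm ?mulr_ge0 ?(ltW t0)// [c * t]mulrC -mulrA -mulrDr.
  by rewrite ler_pM2l// /n -addrA lerD2l ler_wpDr.
have nw2 : `|w2| <= t * n.
  rewrite normrZ ger0_norm ?mulr_ge0 ?(ltW t0)// [c * t]mulrC -mulrA.
  by rewrite ler_pM2l// (le_trans cv)// /n -addrA ler_wpDl// ler_wpDr.
have := dP _ (le_lt_trans nw1 tn); have := dP _ (le_lt_trans nw2 tn).
set a2 := 'd f (x + w2) v - _ - _; set a1 := 'd f (x + w1) v - _ - _.
move=> a2P a1P.
have -> : f (x + t *: u + t *: v) - f (x + t *: u) - f (x + t *: v) + f x
      - t ^+ 2 * 'd (fun y => 'd f y v) x u = t * (a1 - a2).
  have -> : f (x + t *: u + t *: v) - f (x + t *: u) - f (x + t *: v) + f x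
    = f (x + t *: u + t *: v) - f (x + t *: v) - (f (x + t *: u) - f x).
    by move: (f _) (f _) (f _) (f _); clear => *; ring.
  rewrite /a1 /a2 /w1 /w2 addrA diffDr diffZr eqS.
  set A1 := 'd f _ v; set A2 := 'd f _ v; set A3 := 'd f _ v.
  set A4 := 'd _ x u; set A5 := 'd _ x _.
  move: A1 A2 A3 A4 A5; clear => *; ring.
have ea : e * t = e / (2 * n) * (t * n) + e / (2 * n) * (t * n).
  by field; rewrite gt_eqF.
rewrite normrM (gtr0_norm t0) expr2 mulrA mulrC ler_pM2r// ea.
rewrite (le_trans (ler_normB _ _))// lerD//.
  by rewrite (le_trans a1P)// ler_pM2l.
by rewrite (le_trans a2P)// ler_pM2l.
Qed.

(* f is only twice differentiable at x, without continuity of the second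
   derivatives: both sides are the limit of the same second difference. *)
Lemma diff2_sym f x u v : (forall y, differentiable f y) ->
  (forall h, differentiable (fun y => 'd f y h) x) ->
  'd (fun y => 'd f y v) x u = 'd (fun y => 'd f y u) x v.
Proof.
move=> df ddf; apply/eqP; rewrite -subr_eq0 -normr_le0.
apply/ler_addgt0Pr => e e0; rewrite add0r.
have e20 : 0 < e / 2 by rewrite divr_gt0.
have [d d0 dP] := second_difference u df (ddf v) e20.
have [d' d0' dP'] := second_difference v df (ddf u) e20.
pose t := Num.min d d' / 2.
have m0 : 0 < Num.min d d' by rewrite lt_min d0.
have t0 : 0 < t by rewrite divr_gt0.
have tm : t < Num.min d d' by rewrite ltr_pdivrMr// ltr_pMr// ltr1n.
have := dP t; rewrite t0 (lt_le_trans tm) ?ge_min ?lexx//= => /(_ isT).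
have := dP' t; rewrite t0 (lt_le_trans tm) ?ge_min ?lexx ?orbT//= => /(_ isT).
rewrite (addrAC x (t *: v)).
move: (f (x + t *: u + t *: v)) (f (x + t *: u)) (f (x + t *: v)) (f x) => S p r o.
move: ('d (fun y => 'd f y v) x u) ('d (fun y => 'd f y u) x v) => a b.
have : 0 < t ^+ 2 by rewrite exprn_gt0.
clear -e0; move: (t ^+ 2) => t2 t20 h1 h2.
rewrite -(@ler_pM2r _ t2)// -[X in _ * X]gtr0_norm// -normrM.
have -> : (a - b) * t2
    = (S - r - p + o - t2 * b) - (S - p - r + o - t2 * a) by ring.
rewrite (le_trans (ler_normB _ _))// (le_trans (lerD h1 h2))//.
by rewrite le_eqVlt; apply/orP; left; apply/eqP; field.
Qed.

End Calculus.

(** * The norms induced by B and the derivatives of f *)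
Section DualNorm.
Context (R : realType) (V : vectType R) (B : spd_op V).
Local Notation E := (euclid B).

Lemma bnormE (x : E) : `|x| = Num.sqrt (B x x).
Proof. by []. Qed.

Lemma sqr_bnormE (x : E) : `|x| ^+ 2 = B x x.
Proof. by rewrite bnormE sqr_sqrtr// spd_ge0. Qed.

Lemma dualD (s : dual E) (x y : E) : s (x + y) = s x + s y :> R.
Proof. exact: linearD. Qed.

Lemma dualZ (s : dual E) (a : R) (x : E) : s (a *: x) = a * s x :> R.
Proof. exact: linearZ. Qed.

Lemma dualN (s : dual E) (x : E) : s (- x) = - s x :> R.
Proof. exact: linearN. Qed.

Lemma opD (T : 'Hom(E, dual E)) (x y u : E) : T (x + y) u = T x u + T y u :> R.
Proof. by rewrite linearD add_lfunE. Qed.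

Lemma opZ (T : 'Hom(E, dual E)) (a : R) (x u : E) : T (a *: x) u = a * T x u :> R.
Proof. by rewrite linearZ scale_lfunE. Qed.

Lemma spd_lker0 : lker B == 0%VS.
Proof.
apply/lker0P => x y Bxy; apply/eqP; rewrite -subr_eq0; apply/negPn/negP => xy0.
have := spd_pos B xy0; have -> : B (x - y) = 0 by rewrite linearB/= Bxy subrr.
by rewrite zero_lfunE ltxx.
Qed.

(** [B] is injective between spaces of equal dimension, hence onto, so its partial inverse is a
    right inverse on the whole dual. *)
Lemma spd_invK (s : dual V) : B ((B^-1)%VF s) = s.
Proof.
have limgB : limg B = fullv.
  apply/eqP; rewrite eqEdim subvf/=.
  have := limg_ker_dim B fullv; rewrite capfv.
  rewrite (eqP spd_lker0) dimv0 add0n => ->.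
  by rewrite !dimvf /dim/= muln1.
by apply: limg_lfunVK; rewrite limgB memvf.
Qed.

Lemma dnormE (s : dual E) : dnorm s = `|((B^-1)%VF s : E)|.
Proof. by rewrite bnormE spd_invK. Qed.

Lemma dnorm_spd (h : E) : dnorm (B h : dual E) = `|h|.
Proof.
by rewrite dnormE (lker0_lfunK spd_lker0).
Qed.

Lemma sqr_bnormD (a : R) (x y : E) :
  `|x + a *: y| ^+ 2 = `|x| ^+ 2 + 2 * a * B x y + a ^+ 2 * `|y| ^+ 2.
Proof. by rewrite !sqr_bnormE; exact: spdDD. Qed.

Lemma spd_le (x y : E) : B x y <= `|x| * `|y|.
Proof. exact: spd_CS. Qed.

Lemma dnorm_ge0 (s : dual E) : 0 <= dnorm s.
Proof. exact: sqrtr_ge0. Qed.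

Lemma dual_le (s : dual E) (h : E) : s h <= dnorm s * `|h|.
Proof. by rewrite dnormE -{1}(spd_invK s); exact: spd_le. Qed.

(** The dual norm is attained at the unit vector B^(-1) s / |s|_*, so testing there is enough. *)
Lemma dnorm_le (s : dual E) (c : R) : 0 <= c ->
  (forall h : E, `|h| <= 1 -> s h <= c) -> dnorm s <= c.
Proof.
move=> c0 sc; have [->//|s0] := eqVneq (dnorm s) 0.
have sgt0 : 0 < dnorm s by rewrite lt_neqAle eq_sym s0 dnorm_ge0.
set b : E := (B^-1)%VF s; have Bb : B b = s := spd_invK s.
have sb : dnorm s = `|b| by rewrite dnormE.
have := sc ((dnorm s)^-1 *: b); rewrite normrZ ger0_norm ?invr_ge0 ?dnorm_ge0//.
rewrite -sb mulVf// lexx => /(_ isT); rewrite linearZ/= -{2}Bb -sqr_bnormE -sb.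
by rewrite /GRing.scale/= expr2 mulKf.
Qed.

End DualNorm.

(** * Iterated directional derivatives as multilinear forms *)

Section Nabla.
Context (R : realType) (V : vectType R) (B : spd_op V).
Local Notation E := (euclid B).
Implicit Types (f : E -> R) (x h u : E) (hs : seq E).

Lemma gradE f x h : grad f x h = nabla f [:: h] x.
Proof. exact: (lfunE ('d f x)). Qed.

Lemma times_differentiableW m n f : (m <= n)%N ->
  times_differentiable n f -> times_differentiable m f.
Proof. by move=> mn fn hs hsm; apply: fn; rewrite (leq_trans hsm). Qed.

Lemma nablaDr f hs h u x :
  nabla f (h + u :: hs) x = nabla f (h :: hs) x + nabla f (u :: hs) x.
Proof. exact: diffDr. Qed.

Lemma nablaZr f hs (a : R) h x :
  nabla f (a *: h :: hs) x = a * nabla f (h :: hs) x.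
Proof. exact: diffZr. Qed.

Lemma nablaS f h hs x : nabla f (h :: hs) x = 'd (nabla f hs) x h.
Proof. by []. Qed.

Lemma nabla_swap f h u hs x :
  (forall y, differentiable (nabla f hs) y) ->
  (forall w, differentiable (nabla f (w :: hs)) x) ->
  nabla f [:: h, u & hs] x = nabla f [:: u, h & hs] x.
Proof. exact: diff2_sym. Qed.

(** [linfun] represents its argument faithfully only when that is linear. Linearity in [h] comes
    from the differential; linearity in [u] is obtained from the symmetry of second derivatives. *)
Lemma hessE f (f2 : times_differentiable 2 f) x h u :
  hess f x h u = nabla f [:: h; u] x.
Proof.
have sw a b : nabla f [:: a; b] x = nabla f [:: b; a] x.
  by apply: nabla_swap => *; apply: f2.
have lin1 a : linear (fun v : E => nabla f [:: a; v] x : R^o).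
  by move=> k v w; rewrite !(sw a) nablaDr nablaZr.
pose l1 a : {linear E -> R^o} := HB.pack (fun v : E => nabla f [:: a; v] x : R^o)
  (GRing.isLinear.Build _ _ _ _ _ (lin1 a)).
have l1E a v : (linfun (fun v : E => nabla f [:: a; v] x : R^o) : dual E) v
  = nabla f [:: a; v] x by exact: (lfunE (l1 a)).
have lin2 : linear (fun h : E =>
    linfun (fun u : E => nabla f [:: h; u] x : R^o) : dual E).
  move=> k a b; apply/lfunP => v; rewrite add_lfunE scale_lfunE !l1E.
  by rewrite nablaDr nablaZr.
pose l2 : {linear E -> dual E} := HB.pack (fun h : E =>
    linfun (fun u : E => nabla f [:: h; u] x : R^o) : dual E)
  (GRing.isLinear.Build _ _ _ _ _ lin2).
have -> : hess f x h = linfun (fun u : E => nabla f [:: h; u] x : R^o).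
  exact: (lfunE l2).
by rewrite l1E.
Qed.

Lemma hess_sym f (f2 : times_differentiable 2 f) x h u :
  hess f x h u = hess f x u h.
Proof. by rewrite !hessE//; apply: nabla_swap => *; apply: f2. Qed.

End Nabla.

(** * Convexity and Hoelder continuity of derivatives *)
Section DiffIneq.
Context (R : realType) (E : normedModType R).
Implicit Types (f g : E -> R) (x h : E).

(** The differential is the limit of difference quotients as [t] decreases to 0, so a common lower
    bound passes to it. *)
Lemma diff_ge f x h (c : R) : differentiable f x ->
  (forall t : R, 0 < t <= 1 -> t * c <= f (x + t *: h) - f x) ->
  c <= 'd f x h.
Proof.
move=> dfx fc; apply/ler_addgt0Pr => e e0.
have n0 : 0 < `|h| + 1 by rewrite ltr_wpDl.
have [d d0 dP] := diff_near (divr_gt0 e0 n0) dfx.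
pose t := Num.min 1 (d / (2 * (`|h| + 1))).
have t0 : 0 < t by rewrite lt_min ltr01 divr_gt0// mulr_gt0.
have th : `|t *: h| < d.
  rewrite normrZ gtr0_norm// (@lt_le_trans _ _ (t * (2 * (`|h| + 1))))//.
    by rewrite ltr_pM2l//; have := normr_ge0 h; lra.
  by rewrite -ler_pdivlMr ?mulr_gt0// ge_min lexx orbT.
have := dP _ th; rewrite ler_distlC => /andP[+ _].
have := fc t; rewrite t0 ge_min lexx/= => /(_ isT).
rewrite diffZr normrZ gtr0_norm//.
move: ('d f x h) (f _) (f _) => a b o h1 h2.
have h3 : e / (`|h| + 1) * (t * `|h|) <= t * e.
  rewrite [leRHS]mulrC [t * _]mulrC mulrA ler_pM2r// -mulrA -[leRHS]mulr1.
  by rewrite ler_pM2l// mulrC ler_pdivrMr// mul1r lerDl.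
by rewrite -(@ler_pM2l _ t)// mulrDr; lra.
Qed.

Lemma diff_le f x h (c : R) : differentiable f x ->
  (forall t : R, 0 < t <= 1 -> f (x + t *: h) - f x <= t * c) ->
  'd f x h <= c.
Proof.
move=> dfx fc; have dN := differentiableN dfx.
have := @diff_ge (- f) x h (- c) dN; rewrite diffN//= lerN2; apply.
by move=> t /fc; rewrite !fctE; lra.
Qed.

End DiffIneq.

(** * Gradient inequality and nonnegativity of the Hessian *)

Section Convexity.
Context (R : realType) (V : vectType R) (B : spd_op V).
Local Notation E := (euclid B).
Context (f : E -> R) (f_convex : convex_function [set: E] f).
Implicit Types (x y h u : E).
Local Open Scope convex_scope.

Lemma convex_line x h (t : R) : 0 <= t <= 1 ->
  f (x + t *: h) <= f x + t * (f (x + h) - f x).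
Proof.
move=> /andP[t0 t1].
have := @f_convex (Itv01 t0 t1) (x + h) x (in_setT _) (in_setT _).
rewrite convRE/= /unstable.onem.
have -> : (x + h : convex_lmodType E) <| Itv01 t0 t1 |> x = x + t *: h.
  rewrite /conv/= /unstable.onem scalerDr addrAC -scalerDl.
  by rewrite addrCA subrr addr0 scale1r.
by move: (f _) (f _) (f _) => a b c; lra.
Qed.

Lemma convex_grad_le x y : differentiable f x ->
  f x + nabla f [:: y - x] x <= f y.
Proof.
move=> dfx; rewrite addrC -lerBrDr; apply: diff_le => // t /andP[t0 t1].
have := @convex_line x (y - x) t; rewrite t1 ltW// => /(_ isT).
by rewrite addrC (addrC x) subrK; lra.
Qed.

(** The gradient inequalities at [x] and at [x + t *: h], added, show that the derivative along [h]
    does not decrease from the first point to the second. *)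
Lemma convex_hess_ge0 x h : times_differentiable 2 f ->
  0 <= nabla f [:: h; h] x.
Proof.
move=> f2; have df y : differentiable f y by apply: (f2 [::]).
apply: diff_ge; first exact: (f2 [:: h]).
move=> t /andP[t0 t1]; rewrite mulr0.
have := @convex_grad_le x (x + t *: h) (df _).
have := @convex_grad_le (x + t *: h) x (df _).
have -> : x - (x + t *: h) = (- t) *: h by rewrite opprD addrA subrr add0r scaleNr.
have -> : x + t *: h - x = t *: h by rewrite addrAC subrr add0r.
rewrite !nablaZr /=.
move: (f _) (f _) ('d f _ _) ('d f _ _) => a b c d h1 h2.
rewrite -(pmulr_lge0 _ t0) mulrC; lra.
Qed.

End Convexity.

(** * Hoelder bounds and Taylor estimates *)

Section Holder.
Context (R : realType) (V : vectType R) (B : spd_op V).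
Local Notation E := (euclid B).
Implicit Types (f : E -> R) (x y h u : E).

(** The real-valued form in which a finite [smoothness] is used. Exchanging [x] and [y] gives the
    bound for the opposite sign. *)
Definition holder_nabla f p (nu M : R) :=
  times_differentiable p f /\
  forall hs : seq E, size hs = p -> all (fun h : E => `|h| <= 1) hs ->
  forall x y, nabla f hs x - nabla f hs y <= M * `|x - y| `^ nu.

Lemma holder2 f (nu M : R) x y h u : 0 <= M -> holder_nabla f 2 nu M ->
  `|u| <= 1 ->
  nabla f [:: h; u] x - nabla f [:: h; u] y <= `|h| * (M * `|x - y| `^ nu).
Proof.
move=> M0 [_ fM] u1; have [->|h0] := eqVneq h 0.
  by rewrite normr0 mul0r -[0 : E](scale0r 0) !nablaZr !mul0r subrr.
have nh : 0 < `|h| by rewrite normr_gt0.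
have {1 2}-> : h = `|h| *: (`|h|^-1 *: h).
  by rewrite scalerA divff ?gt_eqF// scale1r.
rewrite !(nablaZr _ [:: u] `|h|) -mulrBr ler_pM2l//; apply: fM => //=.
by rewrite u1 normrZ ger0_norm ?invr_ge0// mulVf ?gt_eqF// lexx.
Qed.

(** Two transpositions: one of the inner second derivative, as an identity of functions under the
    outer differential, then one of the two outer directions. *)
Lemma nabla3_rot f h u x : times_differentiable 3 f ->
  nabla f [:: h; h; u] x = nabla f [:: u; h; h] x.
Proof.
move=> f3.
have -> : nabla f [:: h; h; u] x = nabla f [:: h; u; h] x.
  rewrite !nablaS; congr ('d _ x h); apply/funext => y.
  by apply: nabla_swap => *; apply: f3.
by apply: nabla_swap => *; apply: f3.
Qed.

Lemma holder3 f (nu M : R) x y h u : 0 <= M -> holder_nabla f 3 nu M ->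
  `|u| <= 1 ->
  nabla f [:: u; h; h] x - nabla f [:: u; h; h] y
    <= `|h| ^+ 2 * (M * `|x - y| `^ nu).
Proof.
move=> M0 [f3 fM] u1.
(* Homogeneity of degree two: with the repeated direction in front, one factor [k] is pulled out,
   and a swap brings the second copy to the front. *)
have sc (k : R) v z : nabla f [:: u; k *: v; k *: v] z
    = k ^+ 2 * nabla f [:: u; v; v] z.
  rewrite -!nabla3_rot// nablaZr (@nabla_swap _ _ _ _ _ _ [:: u]).
  - by rewrite nablaZr mulrA.
  - by move=> *; apply: f3.
  - by move=> *; apply: f3.
have [->|h0] := eqVneq h 0.
  have s0 z : nabla f [:: u; 0; 0] z = 0.
    by have := sc 0 0 z; rewrite scale0r expr0n mul0r.
  by rewrite !s0 subrr normr0 expr0n mul0r.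
have nh : 0 < `|h| by rewrite normr_gt0.
have eh : h = `|h| *: (`|h|^-1 *: h).
  by rewrite scalerA divff ?gt_eqF// scale1r.
have sch z : nabla f [:: u; h; h] z
    = `|h| ^+ 2 * nabla f [:: u; `|h|^-1 *: h; `|h|^-1 *: h] z.
  by rewrite -sc -eh.
rewrite !sch -mulrBr ler_pM2l ?exprn_gt0//; apply: fM => //=.
by rewrite u1 normrZ ger0_norm ?invr_ge0// mulVf ?gt_eqF// lexx.
Qed.

(** The mean value theorem replaces the increment by the Hessian at an intermediate point, which the
    Hoelder bound compares with the one at [x]. The constant is therefore 1 rather than the 1 / (1 +
    nu) of integration. *)
Lemma taylor2_le f (nu M : R) x h u : 0 <= M -> 0 <= nu ->
  holder_nabla f 2 nu M -> `|u| <= 1 ->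
  nabla f [:: u] (x + h) - nabla f [:: u] x - nabla f [:: h; u] x
    <= `|h| * (M * `|h| `^ nu).
Proof.
move=> M0 nu0 fM u1.
have [c /andP[c0 c1] ->] := @mvt_line _ _ (nabla f [:: u]) x h
  (fun y => fM.1 [:: u] isT y).
rewrite -nablaS (le_trans (holder2 _ _ _ M0 fM u1))//.
rewrite ler_wpM2l// ler_wpM2l//.
apply: ge0_ler_powR; rewrite ?nnegrE//.
by rewrite addrAC subrr add0r normrZ ger0_norm// ler_piMl.
Qed.

(* The Hessian is nonnegative at x - tau u, and it differs from the one at x by
   tau times a third derivative. *)
Lemma nabla3_le f (nu M tau : R) x h u : convex_function [set: E] f ->
  0 <= M -> 0 <= nu -> 0 < tau -> holder_nabla f 3 nu M -> `|u| <= 1 ->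
  nabla f [:: u; h; h] x <=
    nabla f [:: h; h] x / tau + `|h| ^+ 2 * (M * tau `^ nu).
Proof.
move=> fcvx M0 nu0 tau0 fM u1.
have f2 := @times_differentiableW _ _ B 2 3 f isT fM.1.
have := convex_hess_ge0 fcvx (x + tau *: (- u)) h f2.
have [c /andP[c0 c1]] := @mvt_line _ _ (nabla f [:: h; h]) x (tau *: (- u))
  (fun y => fM.1 [:: h; h] isT y).
rewrite -nablaS nablaZr -scaleN1r nablaZr.
set y := x + c *: _ => eqd.
have := @holder3 f nu M x y h u M0 fM u1.
have : `|x - y| `^ nu <= tau `^ nu.
  apply: ge0_ler_powR; rewrite ?nnegrE// ?(ltW tau0)//.
  rewrite /y opprD addrA subrr add0r normrN !normrZ normrN1 mul1r.
  rewrite ger0_norm// gtr0_norm//.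
  rewrite (le_trans (ler_piMl _ c1)) ?mulr_ge0 ?(ltW tau0)//.
  by rewrite ler_piMr ?(ltW tau0)//.
move=> le1 le2 ge0.
have le3 : `|h| ^+ 2 * (M * `|x - y| `^ nu) <= `|h| ^+ 2 * (M * tau `^ nu).
  by rewrite ler_wpM2l ?sqr_ge0// ler_wpM2l.
have le4 : nabla f [:: u; h; h] y <= nabla f [:: h; h] x / tau.
  rewrite ler_pdivlMr//; move: eqd ge0.
  by move: (nabla _ _ _) (nabla _ _ _) (nabla _ _ _) => a b d; lra.
by move: le2 le3 le4; move: (nabla _ _ _) => a; lra.
Qed.

(* Two mean values replace Taylor's formula: the third derivative at x comes with
   an unknown factor in [0, 1] instead of 1/2. *)
Lemma taylor3_le f (nu M tau : R) x h u : convex_function [set: E] f ->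
  0 <= M -> 0 <= nu -> 0 < tau -> holder_nabla f 3 nu M -> `|u| <= 1 ->
  nabla f [:: u] (x + h) - nabla f [:: u] x - nabla f [:: h; u] x
    <= nabla f [:: h; h] x / tau + `|h| ^+ 2 * (M * tau `^ nu)
       + `|h| ^+ 2 * (M * `|h| `^ nu).
Proof.
move=> fcvx M0 nu0 tau0 fM u1.
have f2 := @times_differentiableW _ _ B 2 3 f isT fM.1.
have [c /andP[c0 c1] ->] := @mvt_line _ _ (nabla f [:: u]) x h
  (fun y => fM.1 [:: u] isT y).
rewrite -nablaS.
have [d /andP[d0 d1] ->] := @mvt_line _ _ (nabla f [:: h; u]) x (c *: h)
  (fun y => fM.1 [:: h; u] isT y).
rewrite -nablaS nablaZr (nabla3_rot _ _ _ fM.1); set y := x + d *: _.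
have := @holder3 f nu M y x h u M0 fM u1.
have le3 : `|h| ^+ 2 * (M * `|y - x| `^ nu) <= `|h| ^+ 2 * (M * `|h| `^ nu).
  rewrite ler_wpM2l ?sqr_ge0// ler_wpM2l//.
  apply: ge0_ler_powR; rewrite ?nnegrE//.
  rewrite /y addrAC subrr add0r !normrZ !ger0_norm// mulrA ler_piMl//.
  by rewrite mulr_ile1.
have := @nabla3_le f nu M tau x h u fcvx M0 nu0 tau0 fM u1.
have : 0 <= nabla f [:: h; h] x / tau.
  by rewrite divr_ge0 ?(ltW tau0)// convex_hess_ge0.
have : 0 <= `|h| ^+ 2 * (M * tau `^ nu).
  by rewrite mulr_ge0 ?sqr_ge0// mulr_ge0// powR_ge0.
have : 0 <= `|h| ^+ 2 * (M * `|h| `^ nu).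
  by rewrite mulr_ge0 ?sqr_ge0// mulr_ge0// powR_ge0.
move: le3; move: (nabla f [:: u; h; h] x) (nabla f [:: u; h; h] y).
move: (nabla _ _ _ / _) (_ * (_ * tau `^ _)) (_ * (_ * `|h| `^ _)) (_ * _).
move=> P Q S T N0 N h1 S0 Q0 P0 h2 h3.
(* [N] is the third derivative at the intermediate point. If it is nonnegative, its factor may be
   raised to 1; otherwise the left side is nonpositive. *)
have [Ns0|Ns0] := leP 0 N.
  by rewrite (@le_trans _ _ N) ?ler_piMl//; lra.
by rewrite (@le_trans _ _ 0)//; [rewrite mulr_ge0_le0// ltW|lra].
Qed.

End Holder.

(** * The regularized Newton step *)
Section NewtonStep.
Context (R : realType) (V : vectType R) (B : spd_op V).
Local Notation E := (euclid B).
Context (f : E -> R) (psi : E -> \bar R).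
Context (f_convex : convex_function [set: E] f)
  (f_diff : times_differentiable 2 f)
  (psi_proper : proper_fun psi) (psi_convex : econvex_fun psi).
Implicit Types (x y h : E) (s : dual E).

Lemma dom_fin x : dom psi x -> psi x = (fine (psi x))%:E.
Proof.
by move=> dx; rewrite fineK// fin_numElt dx andbT; case: psi_proper => ->.
Qed.

Lemma subdiff_objective x s y : subdiff psi x s ->
  (objective f psi x + ((grad f x + s) (y - x))%:E <= objective f psi y)%E.
Proof.
move=> [dx /(_ y)]; rewrite /objective (dom_fin dx) add_lfunE gradE.
have := convex_grad_le f_convex y (f_diff (hs := [::]) isT x).
case: (psi y) => [r| |]; rewrite ?leeNy_eq ?addey ?leey// -!EFinD !lee_fin.
by move: (nabla _ _ _) (s _ : R) => a b h1 h2; lra.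
Qed.

Definition smooth_model (xk : E) (lam : R) x : R :=
  grad f xk (x - xk) + 1 / 2 * hess f xk (x - xk) (x - xk)
   + lam / 2 * `|x - xk| ^+ 2.

(** The smooth part is quadratic, so the expansion is exact. Its slope at [x] is minus
    [newton_subgrad], which links minimality to the subdifferential of [psi]. *)
Lemma smooth_model_line xk lam x h (t : R) :
  smooth_model xk lam (x + t *: h) = smooth_model xk lam x
    - t * newton_subgrad f xk lam x h
    + t ^+ 2 * (1 / 2 * hess f xk h h + lam / 2 * `|h| ^+ 2).
Proof.
rewrite /smooth_model /newton_subgrad (addrAC x) sqr_bnormD.
rewrite !add_lfunE !opp_lfunE scale_lfunE.
move: (x - xk) => d; rewrite dualD dualZ !opD !opZ !dualD !dualZ.
rewrite (hess_sym f_diff xk h d) sqr_bnormE /GRing.scale/=.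
move: (grad _ _ d : R) (grad _ _ h : R) (hess _ _ d d : R) (hess _ _ d h : R).
by move: (hess _ _ h h : R) (B d d : R) (B d h : R) => *; field.
Qed.

(** The minimizer is compared with the points of the segment from [xp] to [y]. Convexity of [psi]
    along it leaves a first-order term in [t] that must be nonnegative. *)
Lemma newton_subgradP xk lam xp : argmin (newton_model f psi xk lam) xp ->
  subdiff psi xp (newton_subgrad f xk lam xp).
Proof.
move=> xpmin; have [psiNy [y0 dy0]] := psi_proper.
have dxp : dom psi xp.
  have := xpmin y0; rewrite /newton_model (dom_fin dy0) -EFinD.
  by rewrite /dom /=; case: (psi xp) => // r _; rewrite ltry.
split=> // y; have [dy|] := pselect (dom psi y); last first.
  by rewrite /dom /= => /negP; rewrite -leNgt leye_eq => /eqP->; rewrite leey.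
rewrite (dom_fin dxp) (dom_fin dy) -EFinD lee_fin.
set p0 := fine _; set p1 := fine _; set s := newton_subgrad _ _ _ _.
set K := 1 / 2 * hess f xk (y - xp) (y - xp) + lam / 2 * `|y - xp| ^+ 2.
have tP (t : R) : 0 < t <= 1 -> 0 <= p1 - p0 - s (y - xp) + t * K.
  move=> /andP[t0 t1]; have := xpmin (xp + t *: (y - xp)).
  rewrite /newton_model -/(smooth_model xk lam _) -/(smooth_model xk lam _).
  rewrite smooth_model_line (dom_fin dxp) -/p0 -/s -/K.
  have := @psi_convex y xp t; rewrite (ltW t0) t1 => /(_ isT).
  have -> : t *: y + (1 - t) *: xp = xp + t *: (y - xp).
    by rewrite scalerBl scale1r scalerBr addrCA addrA.
  rewrite (dom_fin dxp) (dom_fin dy) -/p0 -/p1 -!EFinM -EFinD.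
  have := psiNy (xp + t *: (y - xp)).
  case: (psi (xp + t *: (y - xp))) => // r _; rewrite -!EFinD !lee_fin.
  move=> h1 h2; rewrite -(pmulr_rge0 _ t0).
  by move: (s _) (smooth_model _ _ _) h1 h2 => a b; lra.
(* For [K <= 0] the choice [t = 1] gives the claim. Otherwise a negative slope [c] is refuted by a
   [t] below [- c / (2 * K)], for which [t * K] cancels at most half of [c]. *)
have [K0|K0] := leP K 0.
  by have := tP 1; rewrite ltr01 lexx mul1r => /(_ isT); lra.
rewrite leNgt; apply/negP => h0.
set c := p1 - p0 - s (y - xp) in tP; have c0 : c < 0 by rewrite /c; lra.
have t0 : 0 < Num.min 1 (- c / (2 * K)).
  by rewrite lt_min ltr01 divr_gt0 ?oppr_gt0// mulr_gt0.
have := tP (Num.min 1 (- c / (2 * K))).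
rewrite t0 ge_min lexx => /(_ isT); apply/negP; rewrite -ltNge.
rewrite (@le_lt_trans _ _ (c + - c / (2 * K) * K))//.
  by rewrite lerD2l ler_pM2r// ge_min lexx orbT.
have -> : c + - c / (2 * K) * K = c / 2 by field; rewrite gt_eqF.
by lra.
Qed.

(** The subgradient inequalities of [psi] at both points are added, so that its values cancel. The
    Hessian term is kept because for q >= 3 it pays for the third derivative. *)
Lemma newton_step_le xk s lam xp : subdiff psi xk s ->
  argmin (newton_model f psi xk lam) xp ->
  nabla f [:: xp - xk; xp - xk] xk + lam * `|xp - xk| ^+ 2
    <= dnorm (grad f xk + s) * `|xp - xk|.
Proof.
move=> [dxk sxk] /newton_subgradP[dxp sxp].
have := dual_le (grad f xk + s) (- (xp - xk)); rewrite normrN.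
apply: le_trans; have := sxk xp; have := sxp xk.
rewrite (dom_fin dxk) (dom_fin dxp) -!EFinD !lee_fin.
rewrite -(opprB xp xk) !linearN/= sqr_bnormE /newton_subgrad.
rewrite !add_lfunE !opp_lfunE scale_lfunE hessE//.
by rewrite /GRing.scale/=; lra.
Qed.

(** With v = B^(-1) e and r = |h| the test reads |v|^2 + 2 lambda <B v, h> <= 3 lambda^2 r^2. Since
    |v| <= lambda r, the two terms are at most one and two times lambda^2 r^2. *)
Lemma accepted_of_error xk lam xp : 0 < lam ->
  dnorm (grad f xp - grad f xk - hess f xk (xp - xk) : dual E)
    <= lam * `|xp - xk| ->
  accepted f xk lam xp.
Proof.
move=> lam0; rewrite /accepted; set h := xp - xk; set e := _ - _ - _.
have -> : grad f xp + newton_subgrad f xk lam xp = e - lam *: (B h : dual E).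
  by rewrite /newton_subgrad -/h /e !addrA.
set v : E := (B^-1)%VF e; have Bv : B v = e := spd_invK B e.
have -> : e - lam *: (B h : dual E) = B (v + (- lam) *: h).
  by apply/lfunP => u; rewrite opD opZ Bv add_lfunE opp_lfunE scale_lfunE mulNr.
rewrite -Bv dnorm_spd -(opprB xp xk) -/h dnorm_spd sqr_bnormD => le1.
have vh := spd_le v h; have le2 : `|v| ^+ 2 <= (lam * `|h|) ^+ 2.
  by rewrite ler_pXn2r// nnegrE// mulr_ge0// ltW.
have le3 : B v h <= lam * `|h| ^+ 2.
  by rewrite (le_trans vh)// expr2 mulrA ler_wpM2r.
rewrite dualN opD opZ.
rewrite exprMn !sqr_bnormE in le2 le3 *.
rewrite mul1r mulrC ler_pdivrMr ?mulr_gt0//.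
by nra.
Qed.

End NewtonStep.

(** * From finite smoothness constants to Hoelder bounds *)

Section Smoothness.
Context (R : realType) (V : vectType R) (B : spd_op V).
Local Notation E := (euclid B).
Implicit Types (f : E -> R) (x y v : E).

Lemma form_norm_nabla_ge0 p f x y :
  (0 <= form_norm (fun h : p.+1.-tuple E => nabla f h x - nabla f h y)%R)%E.
Proof.
have nabla0 z : nabla f [tuple of nseq p.+1 (0 : E)] z = 0 by exact: linear0.
apply: ereal_sup_ubound; exists [tuple of nseq p.+1 (0 : E)].
  by move=> i; rewrite (tnth_nth 0) nth_nseq ltn_ord normr0 ler01.
by rewrite !nabla0 subrr.
Qed.

Lemma smoothness_holder p f (nu : R) v : v != 0 ->
  (smoothness f p.+1 nu < +oo)%E ->
  exists2 M : R, 0 <= M &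
    smoothness f p.+1 nu = M%:E /\ holder_nabla f p.+1 nu M.
Proof.
rewrite /smoothness => v0; case: asboolP => [fp|//]; set S := [set _ | _ in _].
move=> Soo; have Sub := @ereal_sup_ubound _ S.
(* The distinct points [v] and 0 make the supremum range over a nonempty set; over the empty set it
   would be [-oo]. *)
have S0 : (0 <= ereal_sup S)%E.
  apply: le_trans (Sub _ _); last by exists (v, 0) => //=; exact/eqP.
  by rewrite mule_ge0 ?form_norm_nabla_ge0// lee_fin invr_ge0 powR_ge0.
have Sfin : ereal_sup S \is a fin_num by rewrite ge0_fin_numE.
exists (fine (ereal_sup S)); first exact: fine_ge0.
split; first by rewrite fineK.
split=> // hs hsp hs1 x y.
have [<-|xy] := eqVneq x y.
  by rewrite subrr mulr_ge0 ?powR_ge0 ?fine_ge0.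
have c0 : 0 < `|x - y| `^ nu by rewrite powR_gt0// normr_gt0 subr_eq0.
rewrite -ler_pdivrMr// -lee_fin fineK//.
apply: le_trans (Sub _ _); last by exists (x, y) => //=; exact/eqP.
rewrite EFinM lee_wpmul2r// ?lee_fin ?invr_ge0 ?(ltW c0)//.
have hsP : size hs == p.+1 by exact/eqP.
apply: ereal_sup_ubound; exists (Tuple hsP) => //= i.
by have /allP/(_ (tnth (Tuple hsP) i)) := hs1; apply; rewrite mem_tnth.
Qed.

Definition Mbound f (q M : R) :=
  if q < 3 then holder_nabla f 2 (q - 2) M else holder_nabla f 3 (q - 3) M.

Lemma MconstP f (q : R) v : v != 0 -> (Mconst f q < +oo)%E ->
  exists2 M : R, 0 <= M & Mconst f q = M%:E /\ Mbound f q M.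
Proof.
by rewrite /Mconst /Mbound; case: ifP => _ v0; exact: (smoothness_holder v0).
Qed.

End Smoothness.

(** * Acceptance of large regularization parameters *)

Section Acceptance.
Context (R : realType) (V : vectType R) (B : spd_op V).
Local Notation E := (euclid B).
Context (f : E -> R) (psi : E -> \bar R).
Context (f_convex : convex_function [set: E] f)
  (f_diff : times_differentiable 2 f)
  (psi_proper : proper_fun psi) (psi_convex : econvex_fun psi).

(** Raised to the power q - 1, the hypothesis reads 6 M g^(q-2) <= lambda^(q-1). Dividing by
    lambda^(q-2) leaves g / lambda, the radius that bounds the Newton step. *)
Lemma large_lambda_le (q M lam g : R) : 2 <= q <= 4 -> 0 <= M -> 0 < lam -> 0 < g ->
  (6 * M) `^ (q - 1)^-1 * g `^ ((q - 2) / (q - 1)) <= lam ->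
  6 * (M * (g / lam) `^ (q - 2)) <= lam.
Proof.
move=> /andP[q2 q4] M0 lam0 g0 lamP.
have M60 : 0 <= 6 * M by rewrite mulr_ge0.
have q10 : 0 < q - 1 by lra.
have := @ge0_ler_powR _ (q - 1) (ltW q10) _ _ _ _ lamP.
rewrite !nnegrE (ltW lam0) mulr_ge0 ?powR_ge0// => /(_ isT isT).
rewrite powRM ?powR_ge0// -!powRrM mulVf ?gt_eqF// divfK ?gt_eqF//.
rewrite powRr1// => h.
have l2 : 0 < lam `^ (q - 2) by rewrite powR_gt0.
rewrite -(ler_pM2r l2) -!mulrA -powRM ?divr_ge0 ?(ltW g0) ?(ltW lam0)//.
rewrite divfK ?gt_eqF// mulrA.
rewrite (le_trans h)// -{2}(powRr1 (ltW lam0)) -powRD ?(gt_eqF lam0) ?implybT//.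
by rewrite le_eqVlt; apply/orP; left; apply/eqP; congr (_ `^ _); ring.
Qed.

Lemma newton_error_le (q M lam g : R) (x h u : E) :
  2 <= q <= 4 -> 0 <= M -> 0 < lam -> 0 < g -> Mbound f q M -> `|u| <= 1 ->
  nabla f [:: h; h] x + lam * `|h| ^+ 2 <= g * `|h| ->
  6 * (M * (g / lam) `^ (q - 2)) <= lam ->
  nabla f [:: u] (x + h) - nabla f [:: u] x - nabla f [:: h; u] x <= lam * `|h|.
Proof.
move=> /andP[q2 q4] M0 lam0 g0 fM u1 hle lamP.
have r0 : 0 <= `|h| by [].
have A0 : 0 <= nabla f [:: h; h] x by exact: convex_hess_ge0.
set c := g / lam in lamP; have c0 : 0 < c by rewrite divr_gt0.
have gE : g = c * lam by rewrite /c divfK// gt_eqF.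
(* Dropping the nonnegative Hessian term leaves lambda |h|^2 <= g |h|. *)
have rc : `|h| <= c.
  have [->|h0] := eqVneq h 0; first by rewrite normr0 ltW.
  have nh : 0 < `|h| by rewrite normr_gt0.
  rewrite -(ler_pM2r lam0) -gE -(ler_pM2r nh) [_ * lam]mulrC -mulrA -expr2.
  by rewrite (le_trans _ hle)// lerDr.
move: fM; rewrite /Mbound; case: ltP => [q3|q3] fM.
  have nu0 : 0 <= q - 2 by lra.
  rewrite (le_trans (taylor2_le x h M0 nu0 fM u1))// mulrC ler_wpM2r//.
  have : M * `|h| `^ (q - 2) <= M * c `^ (q - 2).
    by rewrite ler_wpM2l// ge0_ler_powR// nnegrE ltW.
  have : 0 <= M * c `^ (q - 2) by rewrite mulr_ge0// powR_ge0.
  by move: lamP; move: (M * _) (M * _) => *; lra.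
have nu0 : 0 <= q - 3 by lra.
(* Here [tau] is [c]. After multiplication by [c] the Hessian term is at most c lambda r - lambda
   r^2 with r = |h|, and each Hoelder term is at most lambda r^2 / 6. *)
rewrite (le_trans (taylor3_le x h f_convex M0 nu0 c0 fM u1))//.
have cE : c `^ (q - 2) = c * c `^ (q - 3).
  rewrite -{2}(powRr1 (ltW c0)) -powRD ?(gt_eqF c0) ?implybT//.
  by congr (_ `^ _); ring.
have le1 : M * `|h| `^ (q - 3) <= M * c `^ (q - 3).
  by rewrite ler_wpM2l// ge0_ler_powR// nnegrE ltW.
have K0 : 0 <= M * c `^ (q - 3) by rewrite mulr_ge0// powR_ge0.
have {}lamP : c * (6 * (M * c `^ (q - 3))) <= lam by rewrite cE in lamP; lra.
move: lamP; move: (M * _) (M * _) le1 K0.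
move: (`|h|) (nabla _ _ _) r0 A0 hle rc; rewrite gE.
move=> r A r0 A0 hle rc K K' KK' K0 lamP.
clearbody c; rewrite -(ler_pM2l c0).
have -> : c * (A / c + r ^+ 2 * K + r ^+ 2 * K')
    = A + c * (r ^+ 2 * K) + c * (r ^+ 2 * K') by field; rewrite gt_eqF.
have r20 : 0 <= r ^+ 2 by rewrite sqr_ge0.
have h1 : c * (r ^+ 2 * K') <= c * (r ^+ 2 * K).
  by rewrite ler_pM2l// ler_wpM2l.
have h2 : r ^+ 2 * (c * (6 * K)) <= r ^+ 2 * lam by rewrite ler_wpM2l.
have h3 : 0 <= lam * r ^+ 2 by rewrite mulr_ge0// ltW.
nra.
Qed.

Lemma accepted_large_lambda (q M lam : R) (xk xp : E) (s : dual E) :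
  2 <= q <= 4 -> 0 <= M -> 0 < lam -> Mbound f q M -> subdiff psi xk s ->
  argmin (newton_model f psi xk lam) xp ->
  0 < dnorm (grad f xk + s) ->
  (6 * M) `^ (q - 1)^-1 * dnorm (grad f xk + s) `^ ((q - 2) / (q - 1)) <= lam ->
  accepted f xk lam xp.
Proof.
move=> q24 M0 lam0 fM sk xpmin g0 lamP; apply: accepted_of_error => //.
have := newton_step_le f_diff psi_proper psi_convex sk xpmin.
have {lamP} := large_lambda_le q24 M0 lam0 g0 lamP.
set h := xp - xk => lamP hle.
apply: dnorm_le => [|u u1]; first by rewrite mulr_ge0// ltW.
rewrite !add_lfunE !opp_lfunE !gradE hessE//.
have -> : xp = xk + h by rewrite /h addrC subrK.
exact: (newton_error_le q24 M0 lam0 g0 fM u1 hle lamP).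
Qed.

End Acceptance.

(** * The scalar recursion *)
Section Rate.
Context (R : realType).

(** Bernoulli's inequality, from the concavity of [ln] between [u] and 1. *)
Lemma powR_le_tangent (u b : R) : 0 < u -> 0 <= b <= 1 ->
  u `^ b <= 1 + b * (u - 1).
Proof.
move=> u0 /andP[b0 b1].
have := @concave_ln _ (Itv01 b0 b1) u 1 u0 ltr01.
rewrite !convRE/= ln1 mulr0 addr0 /unstable.onem mulr1 => le1.
rewrite /powR gt_eqF//.
have pos : 0 < b * u + (1 - b).
  have [b1'|b1'] := ltrP b 1; last first.
    have bE : b = 1 by lra.
    by rewrite bE; lra.
  by have : 0 <= b * u; [rewrite mulr_ge0// ltW|lra].
rewrite (@le_trans _ _ (b * u + (1 - b)))//; last by lra.
by rewrite -[leRHS]lnK ?posrE// ler_expR.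
Qed.

Lemma powR_inv (a r : R) : 0 <= a -> a^-1 `^ r = a `^ (- r).
Proof. by move=> a0; rewrite -powR_inv1// -powRrM mulN1r. Qed.

(** The tangent bound for u = d'/d, times d, gives b (d - d') <= (1 - (d'/d)^b) d, and the
    hypothesis bounds the left side from below. *)
Lemma descent_step_le (d d' c b : R) : 0 < d' -> d' <= d -> 0 <= b <= 1 ->
  c * d' `^ (1 + b) <= d - d' ->
  b * c <= (d' `^ (- b) - d `^ (- b)) * (d / d').
Proof.
move=> d'0 d'd b01 h; have d0 := lt_le_trans d'0 d'd.
have /andP[b0 b1] := b01.
have p0 : 0 < d' `^ b by rewrite powR_gt0.
have u0 : 0 < d' / d by rewrite divr_gt0.
have := powR_le_tangent u0 b01.
rewrite powRM ?invr_ge0 ?(ltW d0) ?(ltW d'0)// powR_inv ?(ltW d0)// => t.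
rewrite powRN; move: h; rewrite powRD ?(gt_eqF d'0) ?implybT// powRr1 ?(ltW d'0)//.
move: (d `^ (- b)) p0 t.
move: (d' `^ b) => p m p0 t h.
have -> : (p^-1 - m) * (d / d') = (1 - p * m) * d / (p * d').
  by field; rewrite !gt_eqF.
rewrite ler_pdivlMr ?mulr_gt0//.
have h1 : p * m * d <= d + b * (d' - d).
  have -> : d + b * (d' - d) = (1 + b * (d' / d - 1)) * d.
    by field; rewrite gt_eqF.
  by rewrite ler_pM2r.
have h2 : b * (c * (d' * p)) <= b * (d - d') by rewrite ler_wpM2l.
by lra.
Qed.

Lemma descent_rate (alpha b kap D : R) (delta g : nat -> R) (k : nat) :
  (0 < k)%N -> 0 <= alpha <= 1 -> 0 < b <= 1 -> 0 < kap -> 0 < D ->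
  (forall i, (i <= k)%N -> 0 < delta i /\ delta i <= g i * D) ->
  (forall i, (i < k)%N ->
    kap * (g i.+1 / g i) `^ alpha * delta i.+1 `^ (1 + b)
      <= delta i - delta i.+1) ->
  g 0 * D * expR (- (k%:R / 4)) < delta k ->
  delta k `^ b <= 2 / (b * kap * k%:R).
Proof.
move=> k0 /andP[al0 al1] /andP[b0 b1] kap0 D0 dg rec dk.
have dpos i : (i <= k)%N -> 0 < delta i by case/dg.
have gpos i : (i <= k)%N -> 0 < g i.
  by move=> /dg[d0 dl]; rewrite -(pmulr_lgt0 _ D0) (lt_le_trans d0).
have ddec i : (i < k)%N -> delta i.+1 <= delta i.
  move=> ik; rewrite -subr_ge0 (le_trans _ (rec i ik))//.
  by rewrite !mulr_ge0 ?powR_ge0 ?(ltW kap0).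
pose w i := delta i.+1 `^ (- b) - delta i `^ (- b).
have stepw i : (i < k)%N ->
    b * (kap * (g i.+1 / g i) `^ alpha) <= w i * (delta i / delta i.+1).
  move=> ik; apply: descent_step_le; rewrite ?(ltW b0)//.
  - exact: dpos.
  - exact: ddec.
  - exact: rec.
have w0 i : (i < k)%N -> 0 <= w i.
  move=> ik; have y0 : 0 < delta i / delta i.+1.
    by rewrite divr_gt0// dpos// ltnW.
  rewrite -(pmulr_lge0 _ y0) (le_trans _ (stepw _ ik))//.
  by rewrite !mulr_ge0 ?powR_ge0 ?(ltW kap0) ?(ltW b0).
have prodP n : (n <= k)%N ->
    (b * kap) ^+ n * (g n / g 0) `^ alpha
      <= \prod_(i < n) w i * (delta 0 / delta n).
  elim: n => [_|n IH nk].
    by rewrite big_ord0 expr0 !divff ?gt_eqF ?dpos ?gpos// powR1.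
  have := ler_pM _ _ (IH (ltnW nk)) (stepw n nk).
  have -> : (b * kap) ^+ n * (g n / g 0) `^ alpha
      * (b * (kap * (g n.+1 / g n) `^ alpha))
    = (b * kap) ^+ n.+1 * (g n.+1 / g 0) `^ alpha.
    have -> : g n.+1 / g 0 = (g n / g 0) * (g n.+1 / g n).
      by field; rewrite !gt_eqF ?gpos// ltnW.
    have r0 : 0 <= g n / g 0 by rewrite divr_ge0// ltW// gpos// ltnW.
    have r1 : 0 <= g n.+1 / g n by rewrite divr_ge0// ltW// gpos// ltnW.
    by rewrite (powRM _ r0 r1) exprS; ring.
  have -> : \prod_(i < n) w i * (delta 0 / delta n) *
      (w n * (delta n / delta n.+1))
    = \prod_(i < n.+1) w i * (delta 0 / delta n.+1).
    rewrite big_ord_recr/=; field; rewrite !gt_eqF ?dpos// ltnW//.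
  apply; first by rewrite mulr_ge0 ?powR_ge0 ?exprn_ge0 ?mulr_ge0 ?ltW.
  by rewrite !mulr_ge0 ?powR_ge0 ?ltW.
(* The sum of the w_i telescopes, and its negative part - delta_0^(-b) is dropped. *)
have prodw : \prod_(i < k) w i <= (delta k `^ (- b) / k%:R) ^+ k.
  have := (@leif_AGM R 'I_k 'I_k (fun i => w i) (fun i _ => w0 i (ltn_ord i))).1.
  rewrite card_ord => /le_trans; apply.
  have sumw : \sum_(i < k) w i = delta k `^ (- b) - delta 0 `^ (- b).
    by rewrite -(big_mkord xpredT w) telescope_sumr.
  apply: lerXn2r; rewrite ?nnegrE ?divr_ge0 ?powR_ge0//.
    by apply: sumr_ge0 => i _; exact: w0.
  by rewrite ler_pM2r ?invr_gt0 ?ltr0n// sumw gerBl powR_ge0.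
have [dk0 dgk] := dg k (leqnn _); have [d00 dg0] := dg 0%N (leq0n _).
have g00 := gpos 0%N (leq0n _).
set m := expR (- (k%:R / 4)) in dk; have m0 : 0 < m by exact: expR_gt0.
(* The gap is at most g_k D, so its assumed lower bound gives g_k / g_0 >= m; as m <= 1 and alpha <=
   1, also m <= m^alpha. *)
have gk : m <= (g k / g 0) `^ alpha.
  have mg : m <= g k / g 0.
    rewrite ler_pdivlMr// -(ler_pM2r D0) -mulrA mulrC.
    exact: ltW (lt_le_trans dk dgk).
  apply: (@le_trans _ _ (m `^ alpha)); last first.
    by apply: ge0_ler_powR; rewrite ?nnegrE ?(ltW m0)// (le_trans (ltW m0)).
  rewrite -{1}(powRr1 (ltW m0)); apply: ger_powR => //; rewrite m0 -expR0 ler_expR.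
  by rewrite oppr_le0 divr_ge0.
have d0k : delta 0 / delta k <= m^-1.
  rewrite ler_pdivrMr// mulrC ler_pdivlMr//.
  by rewrite (le_trans _ (ltW dk))// ler_pM2r.
have mE : m^-1 = expR (4^-1) ^+ k by rewrite -expRN opprK -expRM_natl.
(* Each telescoped ratio costs at most exp(1/4) per step, both together exp(1/2), so that k-th roots
   can be taken next. *)
have key : (b * kap) ^+ k <= (delta k `^ (- b) / k%:R * expR (2^-1)) ^+ k.
  have -> : 2^-1 = 4^-1 + 4^-1 :> R by field.
  rewrite expRD mulrA !exprMn -mE.
  rewrite -(ler_pM2r m0) divfK ?gt_eqF//.
  apply: (@le_trans _ _ ((b * kap) ^+ k * (g k / g 0) `^ alpha)).
    by rewrite -exprMn ler_wpM2l// exprn_ge0// mulr_ge0// ltW.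
  rewrite (le_trans (prodP k (leqnn _)))// -exprMn; apply: ler_pM => //.
    by apply: prodr_ge0 => i _; exact: w0.
  by rewrite divr_ge0// ltW.
have {}key : b * kap <= delta k `^ (- b) / k%:R * expR 2^-1.
  rewrite -(@ler_pXn2r _ k)// ?nnegrE; first by rewrite mulr_ge0// ltW.
  by rewrite !mulr_ge0 ?powR_ge0 ?expR_ge0// invr_ge0.
(* Equivalent to exp(-1/2) >= 1/2, which is 1 + x <= exp(x) at x = -1/2. *)
have e2 : expR (2^-1 : R) <= 2.
  rewrite -[leRHS]invrK -[leLHS]invrK -expRN lef_pV2 ?posrE ?invr_gt0 ?expR_gt0//.
  by rewrite (le_trans _ (expR_ge1Dx _))//; lra.
have kR : 0 < k%:R :> R by rewrite ltr0n.
have p0 : 0 < delta k `^ b by rewrite powR_gt0.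
rewrite ler_pdivlMr ?mulr_gt0//; move: key; rewrite powRN.
rewrite mulrAC ler_pdivlMr// => h; rewrite (le_trans _ e2)//.
by rewrite mulrC -ler_pdivlMr// [leRHS]mulrC.
Qed.

(** Raising to the power q - 1 turns the exponents 1/(q-1) and 1 + 1/(q-1) into 1 and q. The
    constant 32 is twice the 16 of the descent inequality. *)
Lemma explicit_rate (q M D d kR : R) : 2 <= q <= 4 -> 0 < M -> 0 < D -> 0 < d ->
  0 < kR ->
  d `^ (q - 1)^-1
    <= 2 / ((q - 1)^-1 * (16 * (6 * M) `^ (q - 1)^-1 * D `^ (1 + (q - 1)^-1))^-1
            * kR) ->
  d <= 6 * M * (D `^ q * (32 * (q - 1) / kR) `^ (q - 1)).
Proof.
move=> /andP[q2 q4] M0 D0 d0 k0 h.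
have q10 : 0 < q - 1 by lra.
have M60 : 0 <= 6 * M by rewrite mulr_ge0 ?ltW.
have := @ge0_ler_powR _ (q - 1) (ltW q10) _ _ _ _ h.
rewrite !nnegrE powR_ge0 divr_ge0 ?mulr_ge0 ?invr_ge0 ?mulr_ge0 ?powR_ge0
  ?(ltW k0) ?(ltW q10)//.
move=> /(_ isT isT); rewrite -powRrM mulVf ?gt_eqF// powRr1 ?(ltW d0)//.
move=> /le_trans; apply.
have -> : 2 / ((q - 1)^-1 * (16 * (6 * M) `^ (q - 1)^-1 *
    D `^ (1 + (q - 1)^-1))^-1 * kR)
  = (6 * M) `^ (q - 1)^-1 * (D `^ (1 + (q - 1)^-1) * (32 * (q - 1) / kR)).
  by field; rewrite !gt_eqF ?powR_gt0 ?mulr_gt0.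
have y0 : 0 <= 32 * (q - 1) / kR by rewrite divr_ge0 ?mulr_ge0 ?(ltW k0) ?(ltW q10).
have y1 : 0 <= D `^ (1 + (q - 1)^-1) * (32 * (q - 1) / kR).
  by rewrite mulr_ge0// powR_ge0.
rewrite (powRM _ (powR_ge0 _ _) y1) (powRM _ (powR_ge0 _ _) y0).
rewrite -!powRrM mulVf ?gt_eqF// powRr1//.
have -> // : (1 + (q - 1)^-1) * (q - 1) = q.
by field; rewrite gt_eqF.
Qed.

End Rate.

(** * Convergence of the method *)
Section Convergence.
Context (R : realType) (V : vectType R) (B : spd_op V).
Local Notation E := (euclid B).
Context (f : E -> R) (psi : E -> \bar R).
Context (f_convex : convex_function [set: E] f)
  (f_diff : times_differentiable 2 f)
  (psi_proper : proper_fun psi) (psi_convex : econvex_fun psi).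
Context (alpha H0 : R) (x : nat -> E) (s : nat -> dual E)
  (H : nat -> R) (j : nat -> nat) (z : nat -> nat -> E).
Context (H0_gt0 : 0 < H0)
  (run : super_universal_newton f psi alpha H0 x s H j z).

Local Notation g := (grad_size f x s).

Definition iterate_value i : R := fine (objective f psi (x i)).
Local Notation obj := iterate_value.

Lemma grad_size_ge0 i : 0 <= g i.
Proof. exact: sqrtr_ge0. Qed.

Lemma grad_size_gt0S i : 0 < g i.+1 -> 0 < g i.
Proof.
move=> gi; rewrite lt_neqAle grad_size_ge0 andbT eq_sym; apply/eqP => gi0.
have [_ _ _ /(_ i)[/(_ gi0)[xi si] _]] := run.
by move: gi; rewrite /grad_size xi si -/(g i) gi0 ltxx.
Qed.

Lemma iterate_subdiff i : subdiff psi (x i) (s i).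
Proof.
have [_ s0 _ st] := run; elim: i => // i IH.
have [gi|gi] := eqVneq (g i) 0; first by have [/(_ gi)[-> ->]] := st i.
have gi0 : 0 < g i by rewrite lt_neqAle eq_sym gi grad_size_ge0.
have [_ /(_ gi0)[amin _ _ [xi si] _]] := st i.
rewrite si; apply: newton_subgradP => //.
by rewrite xi; exact: amin.
Qed.

Lemma objective_fin i : objective f psi (x i) = (obj i)%:E.
Proof.
by rewrite /obj /objective (dom_fin psi_proper (iterate_subdiff i).1).
Qed.

Lemma regularization_gt0 i : 0 < g i -> 0 < H i.
Proof.
have [_ _ Hi0 st] := run; elim: i => [_|i IH gi]; first by rewrite Hi0.
have gi0 := grad_size_gt0S gi.
have [_ /(_ gi0)[_ _ _ _ ->]] := st i.
by rewrite divr_gt0// mulr_gt0 ?exprn_gt0// IH.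
Qed.

(** H_{i+1} is a quarter of the accepted coefficient, so the accepted lambda is 4 H_{i+1} g_i^alpha
    and the factor 1/4 of the test becomes 1/16. The subgradient inequality at x_{i+1} turns the
    test into a decrease of F. *)
Lemma iterate_decrease i : 0 < g i -> 0 < H i.+1 /\
  g i.+1 ^+ 2 / (16 * H i.+1 * g i `^ alpha) <= obj i - obj i.+1.
Proof.
move=> gi; have Hi := regularization_gt0 gi.
have [_ _ _ /(_ i)[_ /(_ gi)[amin _ acc [xi si] HS]]] := run.
have HS0 : 0 < H i.+1 by rewrite HS divr_gt0// mulr_gt0 ?exprn_gt0.
split=> //; set lam := 4 ^+ j i * H i * g i `^ alpha in amin acc si.
have lamE : lam = 4 * H i.+1 * g i `^ alpha by rewrite HS /lam; field.
move: acc; rewrite /accepted -xi -si -/(grad_size f x s i.+1).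
have := subdiff_objective f_convex f_diff psi_proper (x i) (iterate_subdiff i.+1).
rewrite !objective_fin -EFinD lee_fin => h1 h2.
rewrite -lerBrDl in h1; have := le_trans h2 h1; rewrite lamE.
have -> : 1 / (4 * (4 * H i.+1 * g i `^ alpha)) = (16 * H i.+1 * g i `^ alpha)^-1.
  by rewrite mul1r; congr (_^-1); ring.
by rewrite mulrC.
Qed.

Lemma objective_nonincr i : obj i.+1 <= obj i.
Proof.
have [gi|gi] := eqVneq (g i) 0.
  by have [_ _ _ /(_ i)[/(_ gi)[xi _] _]] := run; rewrite /obj xi.
have gi0 : 0 < g i by rewrite lt_neqAle eq_sym gi grad_size_ge0.
have [HS0 h] := iterate_decrease gi0; rewrite -subr_ge0 (le_trans _ h)//.
by rewrite divr_ge0 ?sqr_ge0// !mulr_ge0 ?powR_ge0// ltW.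
Qed.

Lemma objective_le0 i : obj i <= obj 0%N.
Proof. by elim: i => // i; apply: le_trans; exact: objective_nonincr. Qed.

Context (D : R) (D_diam : diam (sublevel f psi (x 0%N)) = D%:E).

Lemma sublevel_dist u v : sublevel f psi (x 0%N) u ->
  sublevel f psi (x 0%N) v -> `|u - v| <= D.
Proof.
move=> Su Sv; rewrite -lee_fin -D_diam.
by apply: ereal_sup_ubound; exists (u, v).
Qed.

Lemma iterate_sublevel i : sublevel f psi (x 0%N) (x i).
Proof.
split; first exact: (iterate_subdiff i).1.
by rewrite !objective_fin lee_fin objective_le0.
Qed.

(** Inside the sublevel set the subgradient inequality at x_i and the diameter give the bound;
    outside it, F(y) exceeds F(x_0) >= F(x_i). *)
Lemma opt_value_ge i : ((obj i - g i * D)%:E <= opt_value f psi)%E.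
Proof.
apply/ereal_infP => _ [y dy <-].
have [Sy|] := pselect (objective f psi y <= objective f psi (x 0%N))%E.
  have := subdiff_objective f_convex f_diff psi_proper y (iterate_subdiff i).
  rewrite objective_fin; apply: le_trans; rewrite -EFinD lee_fin lerD2l.
  rewrite lerNl -dualN opprB.
  rewrite (le_trans (dual_le _ _))// ler_wpM2l ?sqrtr_ge0//.
  by apply: sublevel_dist => //; exact: iterate_sublevel.
move=> /negP; rewrite -ltNge => /ltW; apply: le_trans.
rewrite objective_fin lee_fin (le_trans _ (objective_le0 i))// gerBl.
rewrite mulr_ge0 ?grad_size_ge0//.
by rewrite (le_trans _ (sublevel_dist (iterate_sublevel 0) (iterate_sublevel 0))).
Qed.

Lemma opt_value_le i : (opt_value f psi <= (obj i)%:E)%E.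
Proof.
rewrite -objective_fin; apply: ereal_inf_lbound; exists (x i) => //.
exact: (iterate_subdiff i).1.
Qed.

Lemma opt_value_fin : opt_value f psi = (fine (opt_value f psi))%:E.
Proof.
rewrite fineK// fin_numE -ltNye -ltey.
rewrite (lt_le_trans (ltNyr _) (opt_value_ge 0)).
by rewrite (le_lt_trans (opt_value_le 0)) ?ltry.
Qed.

Definition optimality_gap i : R := obj i - fine (opt_value f psi).

Lemma optimality_gap_ge0 i : 0 <= optimality_gap i.
Proof. by rewrite subr_ge0 -lee_fin -opt_value_fin opt_value_le. Qed.

Lemma optimality_gap_le i : optimality_gap i <= g i * D.
Proof.
rewrite /optimality_gap; have := opt_value_ge i; rewrite opt_value_fin lee_fin; lra.
Qed.

Lemma optimality_gap_nonincr m n : (m <= n)%N ->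
  optimality_gap n <= optimality_gap m.
Proof.
move=> /subnK <-; elim: (n - m)%N => // i; apply: le_trans.
by rewrite addSn lerD2r objective_nonincr.
Qed.

Context (alpha_range : 2 / 3 <= alpha <= 1).
Context (q M : R) (q_range : 2 <= q <= 4) (M_ge0 : 0 <= M)
  (fM : Mbound f q M).
Local Notation C := ((6 * M) `^ (q - 1)^-1).
Local Notation theta := (alpha - (q - 2) / (q - 1)).
Context (H0_le : H0 <= C * (g 0%N)^-1 `^ theta).

(** Since q <= 4, the quotient (q - 2) / (q - 1) is at most 2/3, the lower limit for alpha. *)
Lemma theta_ge0 : 0 <= theta.
Proof.
have /andP[q2 q4] := q_range; have /andP[al _] := alpha_range.
rewrite subr_ge0 (le_trans _ al)// ler_pdivrMr; first by lra.
by lra.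
Qed.

(** If M were 0, then C = 0 because its exponent is nonzero, contradicting 0 < H_0 <= C
    g_0^(-theta). *)
Lemma smoothness_constant_gt0 : 0 < M.
Proof.
rewrite lt_neqAle M_ge0 andbT eq_sym; apply/eqP => M0.
have /andP[q2 q4] := q_range.
have := lt_le_trans H0_gt0 H0_le; rewrite M0 mulr0 powR0 ?mul0r ?ltxx//.
by rewrite invr_eq0 gt_eqF//; lra.
Qed.

Lemma grad_size_diam_gt0 i : 0 < optimality_gap i -> 0 < g i /\ 0 < D.
Proof.
move=> di; have := lt_le_trans di (optimality_gap_le i).
have := grad_size_ge0 i; rewrite le_eqVlt => /predU1P[<-|gi].
  by rewrite mul0r ltxx.
by rewrite pmulr_rgt0// gi.
Qed.

Lemma inv_grad_size_le i : 0 < optimality_gap i ->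
  (g i)^-1 `^ theta <= (D / optimality_gap i) `^ theta.
Proof.
move=> di; have [gi D0] := grad_size_diam_gt0 di.
apply: ge0_ler_powR; rewrite ?theta_ge0 ?nnegrE ?invr_ge0 ?(ltW gi)//.
  by rewrite divr_ge0 ?ltW.
by rewrite ler_pdivlMr// mulrC ler_pdivrMr// mulrC optimality_gap_le.
Qed.

Lemma inv_optimality_gap_le i n : (i <= n)%N -> 0 < optimality_gap n ->
  (D / optimality_gap i) `^ theta <= (D / optimality_gap n) `^ theta.
Proof.
move=> im dn; have [_ D0] := grad_size_diam_gt0 dn.
have di := lt_le_trans dn (optimality_gap_nonincr im).
apply: ge0_ler_powR;
  rewrite ?theta_ge0 ?nnegrE ?divr_ge0 ?(ltW D0) ?(ltW di) ?(ltW dn)//.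
by rewrite ler_pM2l// lef_pV2// optimality_gap_nonincr.
Qed.

(** By induction: acceptance at the first trial divides H by 4, while after a rejection the new H is
    a coefficient that was too small, hence below the acceptance threshold. *)
Lemma regularization_le i : 0 < optimality_gap i ->
  H i <= C * (D / optimality_gap i) `^ theta.
Proof.
elim: i => [d0|i IH dS].
  have [_ _ -> _] := run; rewrite (le_trans H0_le)// ler_wpM2l ?powR_ge0//.
  exact: inv_grad_size_le.
have di := lt_le_trans dS (optimality_gap_nonincr (leqnSn i)).
have [gi D0] := grad_size_diam_gt0 di; have Hi := regularization_gt0 gi.
rewrite (@le_trans _ _ (C * (D / optimality_gap i) `^ theta))//; last first.
  by rewrite ler_wpM2l ?powR_ge0// inv_optimality_gap_le.
have [_ _ _ /(_ i)[_ /(_ gi)[amin nacc _ _ ->]]] := run.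
case: (j i) amin nacc => [|n] amin nacc.
  by rewrite (le_trans _ (IH di))// expr0 mul1r; lra.
have gal : 0 < g i `^ alpha by rewrite powR_gt0.
have lam0 : 0 < 4 ^+ n * H i * g i `^ alpha.
  by rewrite !mulr_gt0 ?exprn_gt0.
(* The new coefficient is the one rejected at trial [n]. Above C g_i^(-theta) it would have been
   accepted, because alpha - theta = (q - 2) / (q - 1). *)
have -> : 4 ^+ n.+1 * H i / 4 = 4 ^+ n * H i by rewrite exprS; field.
rewrite (@le_trans _ _ (C * (g i)^-1 `^ theta))//; last first.
  by rewrite ler_wpM2l ?powR_ge0// inv_grad_size_le.
rewrite leNgt; apply/negP => hlt; apply: (nacc n (ltnSn n)).
apply: (accepted_large_lambda f_convex f_diff psi_proper psi_convex q_range
  M_ge0 lam0 fM (iterate_subdiff i) (amin n (leqnSn n)) gi).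
rewrite -/(g i) -ler_pdivrMr// (le_trans _ (ltW hlt))//.
rewrite -mulrA ler_wpM2l ?powR_ge0//.
rewrite powR_inv ?(ltW gi)// -powRN -powRD ?(gt_eqF gi) ?implybT//.
by rewrite le_eqVlt; apply/orP; left; apply/eqP; congr (_ `^ _); ring.
Qed.

(** The bound on H_{i+1} is inserted in the decrease, and g_{i+1}^2 is split into the powers alpha
    and 2 - alpha. The first is kept for the telescoping ratio, the second is at least (delta_{i+1}
    / D)^(2 - alpha). *)
Lemma optimality_gap_recursion i : 0 < optimality_gap i.+1 ->
  (16 * C * D `^ (1 + (q - 1)^-1))^-1 * (g i.+1 / g i) `^ alpha
    * optimality_gap i.+1 `^ (1 + (q - 1)^-1) <= optimality_gap i - optimality_gap i.+1.
Proof.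
move=> dS; have di := lt_le_trans dS (optimality_gap_nonincr (leqnSn i)).
have [gi D0] := grad_size_diam_gt0 di; have [gS _] := grad_size_diam_gt0 dS.
have [HS h] := iterate_decrease gi.
have /andP[q2 q4] := q_range; have M0 := smoothness_constant_gt0.
have C0 : 0 < C by rewrite powR_gt0// mulr_gt0.
have -> : optimality_gap i - optimality_gap i.+1 = obj i - obj i.+1.
  by rewrite /optimality_gap; ring.
apply: le_trans h; set b := (q - 1)^-1; set d := optimality_gap i.+1.
have ga : 0 < g i `^ alpha by rewrite powR_gt0.
have Dd : 0 < (D / d) `^ theta by rewrite powR_gt0// divr_gt0.
apply: (@le_trans _ _ (g i.+1 ^+ 2 / (16 * (C * (D / d) `^ theta) * g i `^ alpha))).
  have -> : (g i.+1 / g i) `^ alpha = g i.+1 `^ alpha / g i `^ alpha.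
    rewrite powRM ?invr_ge0 ?(ltW gi) ?(ltW gS)//.
    by rewrite powR_inv ?(ltW gi)// powRN.
  have dD : 0 < (d / D) `^ (2 - alpha) by rewrite powR_gt0// divr_gt0.
  have -> : (D / d) `^ theta = ((d / D) `^ theta)^-1.
    by rewrite -powRN -invf_div powR_inv ?divr_ge0 ?(ltW dS) ?(ltW D0)//.
  have gE : g i.+1 ^+ 2 = g i.+1 `^ alpha * g i.+1 `^ (2 - alpha).
    rewrite -powRD ?(gt_eqF gS) ?implybT// -powR_mulrn ?(ltW gS)//.
    by congr (_ `^ _); ring.
  have dE : d `^ (1 + b) / D `^ (1 + b) = (d / D) `^ (2 - alpha) * (d / D) `^ theta.
    rewrite -powRD ?(gt_eqF (divr_gt0 dS D0)) ?implybT//.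
    (* The parameter alpha cancels, and 1 - (q - 2) / (q - 1) = 1 / (q - 1). *)
    have -> : 2 - alpha + theta = 1 + b by rewrite /b; field; rewrite gt_eqF//; lra.
    rewrite powRM ?invr_ge0 ?(ltW dS) ?(ltW D0)//.
    by rewrite powR_inv ?(ltW D0)// powRN.
  have dDg : (d / D) `^ (2 - alpha) <= g i.+1 `^ (2 - alpha).
    have /andP[_ al1] := alpha_range.
    apply: ge0_ler_powR; rewrite ?nnegrE ?divr_ge0 ?(ltW dS) ?(ltW gS) ?(ltW D0)//.
      by lra.
    by rewrite ler_pdivrMr// optimality_gap_le.
  have dDt : 0 < (d / D) `^ theta by rewrite powR_gt0// divr_gt0.
  have Db : 0 < D `^ (1 + b) by rewrite powR_gt0.
  have gSa : 0 < g i.+1 `^ alpha by rewrite powR_gt0.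
  have -> : (16 * C * D `^ (1 + b))^-1 * (g i.+1 `^ alpha / g i `^ alpha)
      * d `^ (1 + b)
    = (16 * C)^-1 * (g i.+1 `^ alpha / g i `^ alpha)
      * (d `^ (1 + b) / D `^ (1 + b)).
    by field; rewrite !gt_eqF.
  rewrite dE gE.
  have -> : g i.+1 `^ alpha * g i.+1 `^ (2 - alpha) /
      (16 * (C * ((d / D) `^ theta)^-1) * g i `^ alpha)
    = (16 * C)^-1 * (g i.+1 `^ alpha / g i `^ alpha)
      * (g i.+1 `^ (2 - alpha) * (d / D) `^ theta).
    by field; rewrite !gt_eqF.
  rewrite ler_wpM2l ?ler_pM2r// !mulr_ge0 ?invr_ge0 ?mulr_ge0 ?powR_ge0//.
rewrite ler_wpM2l ?sqr_ge0// lef_pV2 ?posrE ?mulr_gt0// ler_pM2r// ler_pM2l//.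
exact: regularization_le.
Qed.

(** If the exponential term alone does not bound a positive gap, all earlier gaps are positive too,
    and [descent_rate] with kap = 1 / (16 C D^(1+b)) yields the first term. *)
Lemma optimality_gap_rate k : (0 < k)%N ->
  optimality_gap k <= 6 * M * (D `^ q * (32 * (q - 1) / k%:R) `^ (q - 1))
           + g 0%N * D * expR (- (k%:R / 4)).
Proof.
move=> k0; have /andP[q2 q4] := q_range; have M0 := smoothness_constant_gt0.
have T1 : 0 <= 6 * M * (D `^ q * (32 * (q - 1) / k%:R) `^ (q - 1)).
  by rewrite !mulr_ge0 ?powR_ge0 ?(ltW M0).
have [dk|dk] := leP (optimality_gap k) (g 0%N * D * expR (- (k%:R / 4))).
  by rewrite (le_trans dk)// lerDr.
have [dk0|dk0] := ltP 0 (optimality_gap k); last first.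
  rewrite (le_trans dk0)// addr_ge0// mulr_ge0 ?expR_ge0//.
  by rewrite (le_trans (optimality_gap_ge0 0)) ?optimality_gap_le.
have [_ D0] := grad_size_diam_gt0 dk0.
have T2 : 0 <= g 0%N * D * expR (- (k%:R / 4)).
  by rewrite !mulr_ge0 ?expR_ge0 ?grad_size_ge0 ?(ltW D0).
rewrite (@le_trans _ _ (6 * M * (D `^ q * (32 * (q - 1) / k%:R) `^ (q - 1))))//;
  last by rewrite lerDl.
have kR : 0 < k%:R :> R by rewrite ltr0n.
apply: explicit_rate => //.
have C0 : 0 < C by rewrite powR_gt0// mulr_gt0.
have gp i : (i <= k)%N -> 0 < optimality_gap i.
  by move=> ik; exact: lt_le_trans dk0 (optimality_gap_nonincr ik).
apply: (@descent_rate R alpha _ _ D optimality_gap g k k0 _ _ _ D0) => //.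
- by have /andP[al1 al2] := alpha_range; rewrite al2 andbT; lra.
- by rewrite invr_gt0 invf_le1; lra.
- by rewrite invr_gt0 !mulr_gt0// powR_gt0.
- by move=> i ik; split; [exact: gp|exact: optimality_gap_le].
- by move=> i ik; apply: optimality_gap_recursion; exact: gp.
Qed.

End Convergence.

Local Open Scope ereal_scope.

Theorem theorem3 (R : realType) (V : vectType R) (B : spd_op V)
  (f : euclid B -> R) (psi : euclid B -> \bar R)
  (f_convex : convex_function [set: euclid B] f)
  (f_diff : times_differentiable 2 f)
  (psi_proper : proper_fun psi) (psi_closed : closed_fun psi)
  (psi_convex : econvex_fun psi)
  (alpha H0 : R) (alpha_range : (2 / 3 <= alpha <= 1)%R) (H0_gt0 : (0 < H0)%R)
  (x : nat -> euclid B) (s : nat -> dual (euclid B))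
  (H : nat -> R) (j : nat -> nat) (z : nat -> nat -> euclid B)
  (run : super_universal_newton f psi alpha H0 x s H j z)
  (g0_gt0 : (0 < grad_size f x s 0)%R)
  (D : R) (D_diam : diam (sublevel f psi (x 0%N)) = D%:E)
  (q : R) (q_range : (2 <= q <= 4)%R) (Mq_fin : Mconst f q < +oo)
  (H0_le : H0%:E <= Hfun f alpha (grad_size f x s 0))
  (k : nat) (k_ge1 : (1 <= k)%N) :
  objective f psi (x k) - opt_value f psi <=
    6%:E * Mconst f q
      * (D `^ q * (32 * (q - 1) / k%:R) `^ (q - 1))%:E
    + (grad_size f x s 0 * D * expR (- (k%:R / 4)))%:E.
Proof.
(* The assumption g_0 > 0 excludes the trivial space, where the suprema defining the smoothness
   constants would be over empty sets. *)
have [v v0] : exists v : euclid B, v != 0%R.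
  exists ((B^-1)%VF (grad f (x 0) + s 0))%R.
  by rewrite -normr_gt0 -dnormE.
have [M M0 [MqE fM]] := MconstP v0 Mq_fin.
have H0_le' : (H0 <= (6 * M) `^ (q - 1)^-1
    * (grad_size f x s 0)^-1 `^ (alpha - (q - 2) / (q - 1)))%R.
  rewrite -lee_fin (le_trans H0_le)//; apply: ereal_inf_lbound.
  by exists q => //=; rewrite MqE -!EFinM div1r.
rewrite (objective_fin f_diff psi_proper psi_convex run).
rewrite (opt_value_fin f_convex f_diff psi_proper psi_convex H0_gt0 run D_diam).
rewrite MqE -!EFinM -EFinB -EFinD lee_fin.
exact: (optimality_gap_rate f_convex f_diff psi_proper psi_convex H0_gt0 run D_diam
  alpha_range q_range M0 fM H0_le' k_ge1).
Qed.
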